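(* Let $n \in \{3,4\} \cup \{k \in \mathbb{Z} : k \ge 6\}$, and set $b(n) = 3$ if $n \not\equiv 0 \pmod 4$ and $b(n) = 9$ if $n \equiv 0 \pmod 4$. Then the upper bound $b(n)$ on the size of a set of mutually unbiased unit weighing matrices of order $n$ and weight $3$ is tight: there exists a set of exactly $b(n)$ mutually unbiased unit weighing matrices of order $n$ and weight $3$.
   Context: A (unit) weighing matrix of order $n$ and weight $w$, denoted $UW(n,w)$, is an $n\times n$ complex matrix $W$ all of whose entries have absolute value $0$ or $1$ and which satisfies $WW^*=wI_n$, where $W^*$ is the conjugate transpose. Two unit weighing matrices $H,K$ of order $n$ and weight $w$ are unbiased if $HK^*=\sqrt{w}\,L$ for some unit weighing matrix $L$ of order $n$ and weight $w$. A set of unit weighing matrices of the same order and weight is mutually unbiased if any two distinct members are unbiased. *)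

(* Defs.v *)
From mathcomp Require Export all_boot all_order all_algebra.
From mathcomp Require Export classical_sets cardinality reals complex.

Set Implicit Arguments.
Unset Strict Implicit.
Unset Printing Implicit Defensive.

Import GRing.Theory Num.Theory.

Local Open Scope classical_set_scope.
Local Open Scope ring_scope.
Local Open Scope sesquilinear_scope.

Definition unit_weighing (C : numClosedFieldType) (n w : nat) (W : 'M[C]_n) : Prop :=
  (forall i j, `|W i j| = 0 \/ `|W i j| = 1) /\ W *m W ^t* = (w%:R)%:M.

Definition unbiased (C : numClosedFieldType) (n w : nat) (H K : 'M[C]_n) : Prop :=
  exists2 L : 'M[C]_n, unit_weighing w L & H *m K ^t* = sqrtC w%:R *: L.

Definition mutually_unbiased (C : numClosedFieldType) (n w : nat)
    (A : set 'M[C]_n) : Prop :=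
  (forall H, A H -> unit_weighing w H) /\
  (forall H K, A H -> A K -> H <> K -> unbiased w H K).

Definition b (n : nat) : nat := if (4 %| n)%N then 9%N else 3%N.

(* Main.v *)
Require Import Defs.
From mathcomp Require Import zify ring.
From mathcomp Require Import fintype finset.

(** The bound holds because the problem splits into blocks of size 3 or 4.
    Adjoin the matrix sqrt(3) I to the given ones: all cross products
    [H *m K^t*] then have entries of squared modulus 0 or 3.  Two rows of
    weight 3 whose supports share exactly one coordinate have an inner product
    of modulus 1, which is impossible, so supports are 3-sets meeting pairwise
    in 0, 2 or 3 points.  Such a family is built from isolated triples, triples
    inside a common 4-set, and sunflowers of three or more triples through a
    common pair; since every column of a weighing matrix also has weight 3,
    there are no sunflowers ([closed_block]).  Hence every coordinate lies in a
    block of 3 or 4 coordinates that respects all the matrices at once, and if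
    no block has size 3 then the blocks of size 4 partition the index set, so
    that 4 divides n ([closed_block3_or_dvd4]).

    Within a block of size d the rows form systems of vectors of squared norm 3
    whose squared inner products are 0 or 3 across distinct matrices.  The
    Welch inequality for tensor squares ([welch2]) compares the fourth moment
    of these inner products, which Parseval computes exactly, with the
    dimension d(d+1)/2 of the symmetric square.  For t matrices, sqrt(3) I
    included, this gives 6 t <= (d + 1)(t + 2) ([card_le_of_local]), that is
    t <= 4 for d = 3 and t <= 10 for d = 4.

    Conversely, every admissible n is of the form 3 k + 4 l (with k = 0 when 4
    divides n), and direct sums of unbiased families are unbiased
    ([mub_family_block]).  The blocks are obtained by multiplying the columns of
    one weighing matrix by cube roots of unity: for order 3 the Fourier matrix
    and the diagonals (1, x, 1), for order 4 a signed matrix with zero diagonal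
    and the nine diagonals (1, x y, x, y).  Unbiasedness then reduces to the
    fact that a difference of two cube roots of unity, or a sum of three that
    are not all equal, has squared modulus 0 or 3. *)

Set Implicit Arguments.
Unset Strict Implicit.
Unset Printing Implicit Defensive.

Import Order.TTheory GRing.Theory Num.Theory.

(** * Triples meeting pairwise in zero, two or three points *)

Lemma card3_complete (I : finType) (S : {set I}) x y :
  #|S| = 3 -> x \in S -> y \in S -> x != y ->
  exists z, [/\ z != x, z != y & S = [set x; y; z]].
Proof.
move=> S3 xS yS xy.
have /cards1P[z zE] : #|S :\: [set x; y]| == 1.
  rewrite cardsD (setIidPr _) ?cards2 ?xy ?S3 //.
  by apply/subsetP => t /set2P[] ->.
have : z \in S :\: [set x; y] by rewrite zE set11.
rewrite !inE negb_or -andbA => /and3P[zx zy zS]; exists z; split=> //.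
apply/setP => t; move/setP/(_ t): zE; rewrite !inE.
case: (eqVneq t x) => [-> _|tx] /=; first by rewrite xS.
by case: (eqVneq t y) => [-> _|ty] /=; first by rewrite yS.
Qed.

(** The form in which the exclusion of one-point intersections is used: a
    common point of two supports forces a second one. *)
Lemma meet_again (I : finType) (V S : {set I}) x :
  #|V :&: S| != 1 -> x \in V -> x \in S ->
  exists y, [/\ y != x, y \in V & y \in S].
Proof.
move=> VS xV xS; have xVS : x \in V :&: S by rewrite inE xV.
have /card_gt0P[y] : 0 < #|(V :&: S) :\ x|.
  by move: VS; rewrite (cardsD1 x) xVS add1n; case: #|_|.
by rewrite !inE => /and3P[yx yV yS]; exists y.
Qed.

(** [sup a r] is the support of row [r] of the matrix indexed by [a]. *)
Definition closed_under (A I : finType) (sup : A -> I -> {set I})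
    (U : {set I}) :=
  forall a r, sup a r \subset U \/ [disjoint sup a r & U].

(** Start from a support S of the matrix [a0] through [i].  If every support
    is either equal to S or disjoint from S, then S is a block.  Otherwise
    some support T meets S in a pair: S = {x, y, c} and T = {x, y, d}, and
    {x, y, c, d} is a block.  A support containing only one of x, y must
    contain c and d, and one containing neither avoids c and d as well.  What
    remains is a third petal {x, y, e}: it forces every row of [a0] through c
    or d to contain both x and y, so that the three rows through c and the three
    rows through d are six rows through x, whereas there are only three. *)
Lemma closed_block (A I : finType) (sup : A -> I -> {set I}) (a0 : A) (i : I) :
  (forall a r, #|sup a r| = 3) ->
  (forall a b r s, #|sup a r :&: sup b s| != 1) ->
  (forall i, #|[set r | i \in sup a0 r]| = 3) ->
  exists U : {set I}, [/\ i \in U, #|U| = 3 \/ #|U| = 4 & closed_under sup U].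
Proof.
move=> sup3 meet1 col3.
have again a r b s x : x \in sup a r -> x \in sup b s ->
    exists y, [/\ y != x, y \in sup a r & y \in sup b s].
  exact: meet_again.
have [r0] : exists r, r \in [set r | i \in sup a0 r].
  by apply/card_gt0P; rewrite col3.
rewrite inE => iS.
have [cl|] := boolP [forall a, forall r,
    (sup a r \subset sup a0 r0) || [disjoint sup a r & sup a0 r0]].
  exists (sup a0 r0); split=> //; first by left; apply: sup3.
  by move=> a r; apply/orP; move/forallP: cl => /(_ a)/forallP/(_ r).
rewrite negb_forall => /existsP[a1]; rewrite negb_forall => /existsP[r1].
rewrite negb_or => /andP[TS /pred0Pn[x /andP[/= xT xS]]].
have [y [yx yT yS]] := again _ _ _ _ _ xT xS.
rewrite eq_sym in yx.
have [c [cx cy SE]] := card3_complete (sup3 _ _) xS yS yx.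
have [d [dx dy TE]] := card3_complete (sup3 _ _) xT yT yx.
have cd : c != d by apply: contraNneq TS => cd; rewrite SE TE cd.
have [xc xd] : x != c /\ x != d by rewrite ![x == _]eq_sym.
have [yc yd] : y != c /\ y != d by rewrite ![y == _]eq_sym.
have four a r p q s t : p \in sup a r -> q \in sup a r -> s \in sup a r ->
    t \in sup a r -> ~~ uniq [:: p; q; s; t].
  move=> pV qV sV tV; apply/negP => /card_uniqP uniq4.
  have : #|[:: p; q; s; t]| <= #|sup a r|.
    apply/subset_leq_card/subsetP => z.
    by rewrite !inE => /or4P[] /eqP->.
  by rewrite uniq4 sup3.
pose S := sup a0 r0; pose T := sup a1 r1.
(* A support that separates the pair must contain both other points. *)
have half p q a r : p != q -> S = [set p; q; c] -> T = [set p; q; d] ->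
    p \in sup a r -> q \notin sup a r -> c \in sup a r /\ d \in sup a r.
  move=> pq Sp Tp pV qV.
  have [] := again a r a0 r0 p pV; first by rewrite -/S Sp !inE eqxx.
  move=> u [up uV]; rewrite -/S Sp !inE (negbTE up) /=.
  case/orP=> /eqP uE; subst u; first by rewrite uV in qV.
  have [] := again a r a1 r1 p pV; first by rewrite -/T Tp !inE eqxx.
  move=> v [vp vV]; rewrite -/T Tp !inE (negbTE vp) /=.
  by case/orP=> /eqP vE; subst v; first by rewrite vV in qV.
have SE' : S = [set y; x; c] by rewrite /S SE; congr (_ :|: _); rewrite setUC.
have TE' : T = [set y; x; d] by rewrite /T TE; congr (_ :|: _); rewrite setUC.
have yx' : y != x by rewrite eq_sym.
pose U := [set x; y; c; d].
have no_petal a r e : sup a r = [set x; y; e] -> e \in U.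
  move=> VE; rewrite -[X in is_true X]negbK; apply/negP.
  rewrite !inE !negb_or -!andbA => /and4P[ex ey ec ed].
  have VE' : sup a r = [set y; x; e].
    by rewrite VE; congr (_ :|: _); rewrite setUC.
  (* With a third petal e, a separating support would contain p, c, d and e. *)
  have spread p q t : p != q -> S = [set p; q; c] -> T = [set p; q; d] ->
      sup a r = [set p; q; e] -> uniq [:: p; c; d; e] ->
      p \in sup a0 t -> q \in sup a0 t.
    move=> pq Sp Tp Vp uniq4 pW.
    rewrite -[X in is_true X]negbK; apply/negP => qW.
    have [cW dW] := half _ _ _ _ pq Sp Tp pW qW.
    have [] := again a0 t a r p pW; first by rewrite Vp !inE eqxx.
    move=> u [up uW]; rewrite Vp !inE (negbTE up) /=.
    case/orP=> /eqP uE; subst u; first by rewrite uW in qW.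
    by have := four _ _ _ _ _ _ pW cW dW uW; rewrite uniq4.
  have ux : uniq [:: x; c; d; e].
    by rewrite /= !inE !negb_or !(eq_sym _ e) xc xd ex cd ec ed.
  have uy : uniq [:: y; c; d; e].
    by rewrite /= !inE !negb_or !(eq_sym _ e) yc yd ey cd ec ed.
  have xy_c t : c \in sup a0 t -> x \in sup a0 t /\ y \in sup a0 t.
    move=> cW; have [] := again a0 t a0 r0 c cW.
      by rewrite SE !inE eqxx orbT.
    move=> u [uc uW]; rewrite SE !inE (negbTE uc) orbF.
    case/orP=> /eqP uE; subst u; split=> //.
      exact: spread uW.
    exact: (spread y x).
  have xy_d t : d \in sup a0 t -> x \in sup a0 t /\ y \in sup a0 t.
    move=> dW; have [] := again a0 t a1 r1 d dW.
      by rewrite TE !inE eqxx orbT.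
    move=> u [ud uW]; rewrite TE !inE (negbTE ud) orbF.
    case/orP=> /eqP uE; subst u; split=> //.
      exact: spread uW.
    exact: (spread y x).
  have : #|[set t | c \in sup a0 t] :|: [set t | d \in sup a0 t]| <= 3.
    rewrite -(col3 x); apply/subset_leq_card/subsetP => t.
    by rewrite !inE => /orP[/xy_c|/xy_d] [].
  rewrite cardsU !col3 (_ : _ :&: _ = set0) ?cards0 //.
  apply/setP => t; rewrite !inE; apply/negP => /andP[cW dW].
  have [xW yW] := xy_c _ cW.
  have := four _ _ _ _ _ _ xW yW cW dW.
  by rewrite /= !inE !negb_or yx xc xd yc yd cd.
exists U; split.
- apply: (subsetP _ _ iS); rewrite SE; apply/subsetP => t.
  by rewrite !inE => ->.
- right.
  have /card_uniqP /= <- : uniq [:: x; y; c; d].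
    by rewrite /= !inE !negb_or yx xc xd yc yd cd.
  by apply: eq_card => t; rewrite !inE -!orbA.
move=> a r.
have three p t : uniq [:: p; c; d] -> p \in sup a r -> c \in sup a r ->
    d \in sup a r -> t \in sup a r -> t \in [:: p; c; d].
  move=> uniq3 pV cV dV tV; rewrite -[X in is_true X]negbK; apply/negP => tn.
  have := four _ _ _ _ _ _ tV pV cV dV.
  by rewrite cons_uniq tn uniq3.
have [xV|xV] := boolP (x \in sup a r); have [yV|yV] := boolP (y \in sup a r).
- have [e [_ _ VE]] := card3_complete (sup3 _ _) xV yV yx.
  left; rewrite VE; apply/subsetP => t.
  rewrite 2!in_setU !in_set1 -orbA => /or3P[] /eqP->.
  + by rewrite !inE eqxx.
  + by rewrite !inE eqxx !orbT.
  + exact: no_petal VE.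
- left; have [cV dV] := half _ _ _ _ yx SE TE xV yV.
  apply/subsetP => t /(three _ _ _ xV cV dV).
  by rewrite /= !inE !negb_or xc xd cd => /(_ isT)/or3P[] ->;
    rewrite ?orbT.
- left; have [cV dV] := half _ _ _ _ yx' SE' TE' yV xV.
  apply/subsetP => t /(three _ _ _ yV cV dV).
  by rewrite /= !inE !negb_or yc yd cd => /(_ isT)/or3P[] ->;
    rewrite ?orbT.
right; apply/pred0P => t; apply/negP => /andP[/= tV].
have no_xy u : u \in sup a r -> u != x /\ u != y.
  by move=> uV; split; [apply: contraNneq xV|apply: contraNneq yV] => <-.
have [tx ty] := no_xy t tV.
rewrite !inE (negbTE tx) (negbTE ty) /= => /orP[] /eqP tE; subst t.
  have [] := again a r a0 r0 c tV; first by rewrite SE !inE eqxx orbT.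
  move=> u [uc /no_xy[ux uy]].
  by rewrite SE !inE (negbTE ux) (negbTE uy) (negbTE uc).
have [] := again a r a1 r1 d tV; first by rewrite TE !inE eqxx orbT.
move=> u [ud /no_xy[ux uy]].
by rewrite TE !inE (negbTE ux) (negbTE uy) (negbTE ud).
Qed.

(** A nonempty intersection of closed sets is closed and contains a support.
    So when no closed set has size 3, two closed 4-sets that meet coincide, and
    the closed 4-sets partition the index set. *)
Lemma closed_block3_or_dvd4 (A I : finType) (sup : A -> I -> {set I}) (a0 : A) :
  (forall a r, #|sup a r| = 3) ->
  (forall a b r s, #|sup a r :&: sup b s| != 1) ->
  (forall i, #|[set r | i \in sup a0 r]| = 3) ->
  (exists2 U : {set I}, #|U| = 3 & closed_under sup U) \/ 4 %| #|I|.
Proof.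
move=> sup3 meet1 col3.
pose clb (U : {set I}) := [forall a, forall r,
   (sup a r \subset U) || [disjoint sup a r & U]].
have clP U : reflect (closed_under sup U) (clb U).
  apply: (iffP forallP) => cl a; first by move=> r; apply/orP/(forallP (cl a)).
  by apply/forallP => r; apply/orP/cl.
have [/existsP[U /andP[/eqP U3 /clP clU]]|no3] :=
    boolP [exists U : {set I}, (#|U| == 3) && clb U].
  by left; exists U.
right; pose P := [set U : {set I} | (#|U| == 4) && clb U].
rewrite -cardsT (@card_uniform_partition _ 4 P) ?dvdn_mull //.
  by move=> U; rewrite inE => /andP[/eqP].
apply/and3P; split.
- apply/eqP/setP => i; rewrite inE; apply/bigcupP.
  have [U [iU [U3|U4] clU]] := closed_block i sup3 meet1 col3.
    by case/existsP: no3; exists U; rewrite U3 /=; apply/clP.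
  by exists U => //; rewrite inE U4 /=; apply/clP.
- apply/trivIsetP => U V; rewrite !inE => /andP[/eqP U4 /clP clU].
  move=> /andP[/eqP V4 /clP clV].
  apply: contraNT => /pred0Pn[i /andP[/= iU iV]].
  have [r] : exists r, r \in [set r | i \in sup a0 r].
    by apply/card_gt0P; rewrite col3.
  rewrite inE => iS.
  have sub (W : {set I}) : i \in W -> closed_under sup W -> sup a0 r \subset W.
    by move=> iW /(_ a0 r)[//|/pred0P/(_ i)/=]; rewrite iS iW.
  have UV3 : 3 <= #|U :&: V|.
    by rewrite -(sup3 a0 r) subset_leq_card // subsetI !sub.
  have [UV|UV] := eqVneq #|U :&: V| 3.
    case/existsP: no3; exists (U :&: V); rewrite UV /=; apply/clP => a s.
    have [US|US] := clU a s; last first.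
      by right; apply: disjointWr US; apply: subsetIl.
    have [VS|VS] := clV a s; last first.
      by right; apply: disjointWr VS; apply: subsetIr.
    by left; rewrite subsetI US.
  have UV4 : 4 <= #|U :&: V| by rewrite ltn_neqAle eq_sym UV.
  have UE : U :&: V = U by apply/eqP; rewrite eqEcard subsetIl U4.
  have VE : U :&: V = V by apply/eqP; rewrite eqEcard subsetIr V4.
  by rewrite -UE VE.
- by rewrite inE cards0.
Qed.

Local Open Scope ring_scope.
Local Open Scope sesquilinear_scope.

(** * The Welch inequality for tensor squares *)

Definition dot (C : numClosedFieldType) (I : finType) (x y : I -> C) : C :=
  \sum_i x i * (y i)^*.

Lemma dot_conj (C : numClosedFieldType) (I : finType) (x y : I -> C) :
  (dot x y)^* = dot y x.
Proof.
rewrite /dot rmorph_sum; apply: eq_bigr => i _.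
by rewrite rmorphM /= conjCK mulrC.
Qed.

Lemma norm_dot4 (C : numClosedFieldType) (I : finType) (x y : I -> C) :
  `|dot x y| ^+ 4 = dot x y ^+ 2 * dot y x ^+ 2.
Proof. by rewrite -(dot_conj x y) -[4%N]/(2 * 2)%N exprM normCK exprMn. Qed.

Definition tensor2 (C : numClosedFieldType) (I : finType) (x : I -> C)
  (p : I * I) : C := x p.1 * x p.2.

Lemma dot_tensor2 (C : numClosedFieldType) (I : finType) (x y : I -> C) :
  dot (tensor2 x) (tensor2 y) = dot x y ^+ 2.
Proof.
rewrite /dot /tensor2 expr2 big_distrlr /= pair_bigA /=.
by apply: eq_bigr => p _; rewrite rmorphM mulrACA.
Qed.

(** Cauchy-Schwarz, in the Hilbert-Schmidt inner product, between the frame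
    operator T of the tensor squares of the [u j] and S, which is twice the
    projector onto the symmetric tensors.  The trace of T S is twice the sum
    of the fourth powers of the norms, the squared norm of S is 2 d (d + 1),
    where d is the size of [I], and the squared norm of T is the fourth moment
    on the right. *)
Lemma welch2 (C : numClosedFieldType) (I J : finType) (u : J -> I -> C) :
  2 * (\sum_j dot (u j) (u j) ^+ 2) ^+ 2 <=
  (#|I| * #|I|.+1)%:R * \sum_j \sum_k `|dot (u j) (u k)| ^+ 4.
Proof.
set N := \sum_j dot (u j) (u j) ^+ 2; set A := \sum_j \sum_k _.
have [I0|I_gt0] := posnP #|I|.
  rewrite I0 mul0n mul0r [N]big1 ?expr0n ?mulr0 // => j _.
  by rewrite /dot big1 ?expr0n // => i _; have := card0_eq I0 i.
set X := ((I * I) * (I * I))%type.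
pose sw (p : I * I) := (p.2, p.1).
pose t j := tensor2 (u j).
pose T (x : X) := \sum_j t j x.1 * (t j x.2)^*.
pose S (x : X) : C := (x.2 == x.1)%:R + (x.2 == sw x.1)%:R.
have sumS F : \sum_x F x * S x = \sum_p (F (p, p) + F (p, sw p)).
  transitivity (\sum_p \sum_q F (p, q) * S (p, q)).
    by rewrite pair_bigA; apply: eq_bigr => -[].
  apply: eq_bigr => p _; under eq_bigr do rewrite mulrDr /=.
  rewrite big_split /= (bigD1 p) //= eqxx mulr1 big1 ?addr0; last first.
    by move=> q /negbTE ->; rewrite mulr0.
  rewrite (bigD1 (sw p)) //= eqxx mulr1 big1 ?addr0 //.
  by move=> q /negbTE ->; rewrite mulr0.
have SS : \sum_x S x * S x = 2 * (#|I| * #|I|.+1)%:R.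
  rewrite sumS /S /=; under eq_bigr => p _.
    rewrite !eqxx [p == _]eq_sym.
    rewrite [_ + 1]addrC; over.
  rewrite big_split /= -mulr2n mulr_natl; congr (_ *+ 2).
  rewrite big_split /= sumr_const card_prod mulnS natrD addrC; congr (_ + _).
  transitivity (\sum_i \sum_j (sw (i, j) == (i, j))%:R : C).
    by rewrite pair_bigA; apply: eq_bigr => -[].
  rewrite -[X in X%:R]sum1_card natr_sum; apply: eq_bigr => i _.
  rewrite (bigD1 i) //= eqxx big1 ?addr0 // => j /negbTE ji.
  by rewrite /sw /eq_op /= ji.
have TS : \sum_x T x * S x = 2 * N.
  rewrite sumS mulr_natl mulr2n.
  have tsw j p : t j (sw p) = t j p by rewrite /t /tensor2 mulrC.
  rewrite big_split /=; congr (_ + _); rewrite exchange_big /=;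
    apply: eq_bigr => j _; rewrite -dot_tensor2 //.
  by apply: eq_bigr => p _; rewrite tsw.
have TcS : \sum_x (T x)^* * S x = 2 * N.
  rewrite -TS -[LHS]conjCK.
  rewrite rmorph_sum /=; under eq_bigr do rewrite rmorphM /= conjCK.
  under eq_bigr do rewrite /S rmorphD /= !conjC_nat -/(S _).
  rewrite TS rmorphM /= conjC_nat; congr (_ * _); rewrite rmorph_sum.
  by apply: eq_bigr => j _; rewrite rmorphXn /= dot_conj.
have TT : \sum_x T x * (T x)^* = A.
  under eq_bigr => x _ do rewrite rmorph_sum big_distrlr /=.
  rewrite exchange_big /=; apply: eq_bigr => j _.
  rewrite exchange_big /=; apply: eq_bigr => k _.
  rewrite norm_dot4 -!dot_tensor2 {1 2}/dot big_distrlr /= pair_bigA /=.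
  apply: eq_bigr => x _; rewrite /t [X in _ * X]rmorphM /= conjCK; ring.
set B := (#|I| * #|I|.+1)%:R : C.
have B_gt0 : 0 < B by rewrite ltr0n muln_gt0 I_gt0.
(* Up to the factor B, this is T minus its component along S: as |S|^2 = 2 B
   and <T, S> = 2 N, that component is (N / B) S. *)
have : 0 <= \sum_x `|B * T x - N * S x| ^+ 2.
  by apply: sumr_ge0 => x _; rewrite exprn_ge0.
have Nr : N^* = N.
  rewrite rmorph_sum; apply: eq_bigr => j _.
  by rewrite rmorphXn /= dot_conj.
have -> : \sum_x `|B * T x - N * S x| ^+ 2 =
   \sum_x (B ^+ 2 * (T x * (T x)^*) - B * N * (T x * S x)
       - B * N * ((T x)^* * S x) + N ^+ 2 * (S x * S x)).
  apply: eq_bigr => x _; rewrite normCK rmorphB !rmorphM /= Nr conjC_nat.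
  rewrite {2}/S rmorphD /= !conjC_nat -/(S x); ring.
rewrite !(big_split, sumrN) /= -!mulr_sumr TT TS TcS SS -/B.
have -> : B ^+ 2 * A - B * N * (2 * N) - B * N * (2 * N) + N ^+ 2 * (2 * B) =
   B * (B * A - 2 * N ^+ 2) by ring.
by rewrite pmulr_rge0 // subr_ge0.
Qed.

(** * Counting matrices within a block *)

Lemma mulmx_conj_trE (C : numClosedFieldType) m n (A B : 'M[C]_(m, n)) r s :
  (A *m B^t*) r s = dot (A r) (B s).
Proof. by rewrite mxE; apply: eq_bigr => i _; rewrite !mxE. Qed.

Lemma scaled_unitary_cols (C : numClosedFieldType) n (M : 'M[C]_n) (c : C) :
  c != 0 -> M *m M^t* = c%:M -> M^t* *m M = c%:M.
Proof.
move=> c0 MM; have : (c^-1 *: M) *m M^t* = 1%:M.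
  by rewrite -scalemxAl MM scale_scalar_mx mulVf.
move/mulmx1C; rewrite -scalemxAr => /(congr1 (fun A => c *: A)).
by rewrite scalerA mulfV // scale1r scale_scalar_mx mulr1.
Qed.

Lemma sum_col_conj (C : numClosedFieldType) n (M : 'M[C]_n) (c : C) i j :
  c != 0 -> M *m M^t* = c%:M ->
  \sum_r M r i * (M r j)^* = c *+ (i == j).
Proof.
move=> c0 /(scaled_unitary_cols c0)/matrixP/(_ j i).
rewrite [RHS]mxE eq_sym => <-; rewrite mxE; apply: eq_bigr => r _.
by rewrite !mxE mulrC.
Qed.

Lemma sum_norm_col (C : numClosedFieldType) n (M : 'M[C]_n) (c : C) i :
  c != 0 -> M *m M^t* = c%:M -> \sum_r `|M r i| ^+ 2 = c.
Proof.
move=> c0 MM; under eq_bigr do rewrite normCK.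
by rewrite (sum_col_conj _ _ c0 MM) eqxx.
Qed.

(** Only the columns selected by [h] enter, which is why orthogonality of the
    columns, rather than of the rows, of [M] is what matters. *)
Lemma parseval_cols (C : numClosedFieldType) n (I : finType) (h : I -> 'I_n)
    (M : 'M[C]_n) (c : C) (x : I -> C) :
  injective h -> c != 0 -> M *m M^t* = c%:M ->
  \sum_s `|dot x (fun k => M s (h k))| ^+ 2 = c * dot x x.
Proof.
move=> h_inj c0 MM.
under eq_bigr => s _ do rewrite normCK dot_conj /dot big_distrlr /=.
rewrite exchange_big mulr_sumr; apply: eq_bigr => i _ /=.
rewrite exchange_big (bigD1 i) //= [X in _ + X]big1 ?addr0; last first.
  move=> j ji.
  transitivity (x i * (x j)^* * \sum_s M s (h j) * (M s (h i))^*).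
    by rewrite mulr_sumr; apply: eq_bigr => s _; ring.
  by rewrite (sum_col_conj _ _ c0 MM) (inj_eq h_inj) (negbTE ji) mulr0.
transitivity (x i * (x i)^* * \sum_s M s (h i) * (M s (h i))^*).
  by rewrite mulr_sumr; apply: eq_bigr => s _; ring.
by rewrite (sum_col_conj _ _ c0 MM) eqxx mulrC.
Qed.

(** The restrictions to [U] of all rows of all matrices are fed to [welch2].
    Locality makes restricted inner products equal to full ones or to zero, so
    their fourth powers are 9 (same matrix) or 3 (distinct matrices) times
    their squares, which Parseval sums. *)
Lemma card_le_of_local (C : numClosedFieldType) n (T : finType)
    (M : T -> 'M[C]_n) (U : {set 'I_n}) :
  (0 < #|U|)%N -> (0 < #|T|)%N ->
  (forall a, M a *m (M a)^t* = 3%:M) ->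
  (forall a b, a <> b -> forall r s,
     `|(M a *m (M b)^t*) r s| ^+ 2 = 0 \/ `|(M a *m (M b)^t*) r s| ^+ 2 = 3) ->
  (forall a r, {in U, forall i, M a r i = 0} \/
               {in ~: U, forall i, M a r i = 0}) ->
  (6 * #|T| <= #|U|.+1 * #|T|.+2)%N.
Proof.
move=> U_gt0 T_gt0 MM Mab Mloc.
have c3 : 3 != 0 :> C by rewrite pnatr_eq0.
pose u (p : T * 'I_n) (k : 'I_#|U|) : C := M p.1 p.2 (enum_val k).
have uE p q : dot (u p) (u q) = 0 \/
    dot (u p) (u q) = (M p.1 *m (M q.1)^t*) p.2 q.2.
  have -> : dot (u p) (u q) = \sum_(i in U) M p.1 p.2 i * (M q.1 q.2 i)^*.
    by rewrite big_enum_val.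
  have [Z|Z] := Mloc p.1 p.2.
    by left; rewrite big1 // => i iU; rewrite Z ?mul0r.
  right; rewrite mulmx_conj_trE /dot [RHS](bigID (mem U)) /=.
  by rewrite [X in _ + X]big1 ?addr0 // => i iU; rewrite Z ?mul0r // inE.
pose e p := dot (u p) (u p).
have row_sum p b : \sum_s `|dot (u p) (u (b, s))| ^+ 2 = 3 * e p.
  exact: (parseval_cols _ (@enum_val_inj _ _) c3 (MM b)).
have e_sum a : \sum_r e (a, r) = 3 * #|U|%:R.
  rewrite exchange_big /=.
  under eq_bigr do rewrite (sum_col_conj _ _ c3 (MM a)) eqxx.
  by rewrite sumr_const card_ord [RHS]mulr_natr.
(* A restricted row has squared norm 0 or 3. *)
have e_sq p : e p ^+ 2 = 3 * e p.
  rewrite /e expr2; case: (uE p p) => ->; rewrite ?mulr0 // MM mxE eqxx.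
  by rewrite mulr1n.
have same a r : \sum_s `|dot (u (a, r)) (u (a, s))| ^+ 4 = 27 * e (a, r).
  transitivity (9 * \sum_s `|dot (u (a, r)) (u (a, s))| ^+ 2); last first.
    by rewrite row_sum; ring.
  rewrite mulr_sumr; apply: eq_bigr => s _.
  case: (uE (a, r) (a, s)) => ->; first by rewrite normr0 !expr0n mulr0.
  rewrite MM mxE; case: (_ == _); last by rewrite normr0 !expr0n mulr0.
  by rewrite mulr1n normr_nat; ring.
have diff a b r : a <> b ->
    \sum_s `|dot (u (a, r)) (u (b, s))| ^+ 4 = 9 * e (a, r).
  move=> ab.
  transitivity (3 * \sum_s `|dot (u (a, r)) (u (b, s))| ^+ 2); last first.
    by rewrite row_sum; ring.
  rewrite mulr_sumr; apply: eq_bigr => s _.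
  case: (uE (a, r) (b, s)) => ->; first by rewrite normr0 !expr0n mulr0.
  rewrite -[4%N]/(2 * 2)%N exprM /=.
  by case: (Mab _ _ ab r s) => ->; ring.
have := welch2 u.
have -> : \sum_j dot (u j) (u j) ^+ 2 = 9 * #|T|%:R * #|U|%:R.
  transitivity (\sum_a \sum_r e (a, r) ^+ 2).
    by rewrite pair_bigA; apply: eq_bigr => -[].
  under eq_bigr => a _.
    under eq_bigr do rewrite e_sq.
    rewrite -mulr_sumr e_sum; over.
  rewrite sumr_const; ring.
have -> : \sum_j \sum_k `|dot (u j) (u k)| ^+ 4 =
    9 * (#|T|%:R + 2) * (#|T|%:R * (3 * #|U|%:R)).
  transitivity (\sum_a \sum_r 9 * (#|T|%:R + 2) * e (a, r)).
    rewrite [RHS]pair_bigA; apply: eq_bigr => -[a r] _ /=.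
    transitivity (\sum_b \sum_s `|dot (u (a, r)) (u (b, s))| ^+ 4).
      by rewrite pair_bigA; apply: eq_bigr => -[].
    rewrite (bigD1 a) //= same.
    under eq_bigr => b ba.
      rewrite diff; last by move=> ab; rewrite ab eqxx in ba.
      over.
    rewrite sumr_const -mulr_natl.
    have -> : #|[pred b | b != a]| = #|T|.-1.
      by rewrite -(cardC1 a).
    by rewrite -[in RHS](prednK T_gt0) -natr1; field.
  under eq_bigr => a _ do rewrite -mulr_sumr e_sum.
  by rewrite sumr_const; field.
rewrite card_ord.
move: #|T| #|U| T_gt0 U_gt0 => m d m0 d0 le.
have {le} : ((27 * m * d * d * (6 * m))%:R : C) <=
   (27 * m * d * d * (d.+1 * m.+2))%:R.
  apply: le_trans (le_trans le _); rewrite le_eqVlt; apply/orP; left; apply/eqP.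
    by rewrite !natrM; ring.
  by rewrite !natrM -[m.+2]addn2 natrD; ring.
by rewrite ler_nat leq_pmul2l // !muln_gt0 m0 d0.
Qed.

(** * The upper bound *)

Definition supp (C : numClosedFieldType) (n : nat) (M : 'M[C]_n) (r : 'I_n) :
  {set 'I_n} := [set i | M r i != 0].

Lemma natr_card_nz (C : numClosedFieldType) (I : finType) (f : I -> C) :
  (forall i, `|f i| = 0 \/ `|f i| = 1) ->
  #|[set i | f i != 0]|%:R = \sum_i `|f i| ^+ 2.
Proof.
move=> f01; rewrite -sum1_card natr_sum big_mkcond /=; apply: eq_bigr => i _.
rewrite inE; case: (f01 i) => fi; last by rewrite -normr_eq0 fi oner_eq0 expr1n.
by rewrite fi; move/eqP: fi; rewrite normr_eq0 => ->; rewrite expr0n.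
Qed.

Lemma card_supp (C : numClosedFieldType) n w (M : 'M[C]_n) r :
  unit_weighing w M -> #|supp M r| = w.
Proof.
move=> [M01 MM]; apply/eqP; rewrite -(eqr_nat C) natr_card_nz //.
move/matrixP/(_ r r): MM; rewrite mulmx_conj_trE mxE eqxx mulr1n => <-.
by apply/eqP; apply: eq_bigr => i _; rewrite normCK.
Qed.

Lemma card_col_supp (C : numClosedFieldType) n w (M : 'M[C]_n) i :
  (0 < w)%N -> unit_weighing w M -> #|[set r | i \in supp M r]| = w.
Proof.
move=> w_gt0 [M01 MM]; apply/eqP; rewrite -(eqr_nat C).
have w0 : w%:R != 0 :> C by rewrite pnatr_eq0 -lt0n.
rewrite -[X in _ == X](sum_norm_col i w0 MM) -natr_card_nz //.
by apply/eqP; congr (_%:R); apply: eq_card => r; rewrite !inE.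
Qed.

Lemma norm_dot_meet1 (C : numClosedFieldType) n w (H K : 'M[C]_n) r s :
  unit_weighing w H -> unit_weighing w K -> #|supp H r :&: supp K s| = 1%N ->
  `|(H *m K^t*) r s| ^+ 2 = 1.
Proof.
move=> [H01 _] [K01 _] /eqP/cards1P[i iE].
have /setIP[] : i \in supp H r :&: supp K s by rewrite iE set11.
rewrite !inE => Hi Ki; rewrite mulmx_conj_trE /dot (bigD1 i) //= big1 ?addr0.
  rewrite normrM norm_conjC.
  case: (H01 r i) => [/normr0P Z|->]; first by rewrite Z in Hi.
  case: (K01 s i) => [/normr0P Z|->]; first by rewrite Z in Ki.
  by rewrite mulr1 expr1n.
move=> j ji; have : j \notin supp H r :&: supp K s by rewrite iE inE.
rewrite !inE negb_and !negbK => /orP[] /eqP->; first by rewrite mul0r.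
by rewrite conjC0 mulr0.
Qed.

Definition mub_family (C : numClosedFieldType) (n : nat) (T : finType)
    (H : T -> 'M[C]_n) :=
  (forall a, unit_weighing 3 (H a)) /\
  (forall a b, a <> b -> unbiased 3 (H a) (H b)).

Lemma unbiased_norm (C : numClosedFieldType) n w (H K : 'M[C]_n) :
  unbiased w H K -> forall r s,
  `|(H *m K^t*) r s| ^+ 2 = 0 \/ `|(H *m K^t*) r s| ^+ 2 = w%:R.
Proof.
move=> [L [L01 _] ->] r s; rewrite mxE normrM.
case: (L01 r s) => ->; first by left; rewrite mulr0 expr0n.
by right; rewrite mulr1 -normrX sqrtCK normr_nat.
Qed.

(** The scalar matrix sqrt(3) I joins the family as [None]: it is no weighing
    matrix, but it satisfies the hypotheses of [card_le_of_local], and without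
    it the bounds would be 4 and 10. *)
Lemma card_mub_family (C : numClosedFieldType) n (T : finType)
    (H : T -> 'M[C]_n) : (0 < n)%N -> mub_family H -> (#|T| <= b n)%N.
Proof.
move=> n_gt0 [Hw Hub]; have [-> //|T_gt0] := posnP #|T|.
have [a0 _] := card_gt0P T_gt0.
pose sup a r := supp (H a) r.
have sup3 a r : #|sup a r| = 3%N by apply: card_supp.
have meet1 a b r s : #|sup a r :&: sup b s| != 1%N.
  apply/eqP => /(norm_dot_meet1 (Hw a) (Hw b)).
  have [->|/eqP ab] := eqVneq a b.
    case: (Hw b) => _ ->; rewrite mxE; case: (_ == _).
      rewrite mulr1n normr_nat -natrX => /eqP.
      by rewrite pnatr_eq1.
    by rewrite mulr0n normr0 expr0n => /eqP; rewrite eq_sym oner_eq0.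
  case: (unbiased_norm (Hub _ _ ab) r s) => -> /eqP; last by rewrite pnatr_eq1.
  by rewrite eq_sym oner_eq0.
have col3 i : #|[set r | i \in sup a0 r]| = 3%N by apply: card_col_supp.
have bound (U : {set 'I_n}) : (0 < #|U|)%N -> closed_under sup U ->
    (6 * #|T|.+1 <= #|U|.+1 * #|T|.+3)%N.
  move=> U_gt0 clU; rewrite -card_option.
  pose M (o : option T) := if o is Some a then H a else (sqrtC 3)%:M.
  have sq3 : `|sqrtC 3 : C| ^+ 2 = 3 by rewrite -normrX sqrtCK normr_nat.
  have tr3 : ((sqrtC 3)%:M : 'M[C]_n)^t* = (sqrtC 3)%:M.
    rewrite tr_scalar_mx map_scalar_mx /= (conj_Creal _) //.
    by rewrite ger0_real // sqrtC_ge0 ler0n.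
  apply: (card_le_of_local (M := M)) => //.
  - by rewrite card_option.
  - case=> [a|] /=; first by case: (Hw a).
    by rewrite tr3 -scalar_mxM -expr2 sqrtCK.
  - have sc a r s : `|H a r s| ^+ 2 * 3 = 0 \/ `|H a r s| ^+ 2 * 3 = 3 :> C.
      case: (Hw a) => /(_ r s)[] -> _; first by left; rewrite expr0n mul0r.
      by right; rewrite expr1n mul1r.
    case=> [a|] [b|] //= ab r s.
    + by apply: unbiased_norm; apply: Hub => E; apply: ab; rewrite E.
    + by rewrite tr3 mul_mx_scalar mxE normrM mulrC exprMn sq3.
    + rewrite mul_scalar_mx 3!mxE normrM norm_conjC exprMn sq3 mulrC; exact: sc.
  - case=> [a|] r /=.
      case: (clU a r) => [/subsetP sub|/pred0P dis].
        right=> i; rewrite inE; apply: contraNeq => Hi; apply: sub.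
        by rewrite inE.
      left=> i iU; move: (dis i) => /=; rewrite iU andbT inE.
      by move/negbT; rewrite negbK => /eqP.
    have [rU|rU] := boolP (r \in U); [right|left] => i iU; rewrite mxE;
      case: eqP => // ri; by rewrite -ri ?inE ?rU // (negbTE rU) in iU.
have [[U U3 clU]|] := closed_block3_or_dvd4 sup3 meet1 col3.
  have := bound U; rewrite U3 /b => /(_ isT clU); case: (4 %| n)%N; lia.
rewrite card_ord /b => -> .
have [U [_ U34 clU]] := closed_block (Ordinal n_gt0) sup3 meet1 col3.
have := bound U; case: U34 => -> /(_ isT clU); lia.
Qed.

(** * Unbiased families from cube roots of unity *)

(** The matrix [L] is forced, and its Gram matrix is automatically scalar, so
    unbiasedness is a condition on the moduli of the entries alone. *)
Lemma unbiased_of_norm (C : numClosedFieldType) n w (H K : 'M[C]_n) :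
  (0 < w)%N -> unit_weighing w H -> unit_weighing w K ->
  (forall r s, `|(H *m K^t*) r s| ^+ 2 = 0 \/ `|(H *m K^t*) r s| ^+ 2 = w%:R) ->
  unbiased w H K.
Proof.
move=> w_gt0 [_ HH] [_ KK] HK.
have w0 : w%:R != 0 :> C by rewrite pnatr_eq0 -lt0n.
have sw0 : sqrtC w%:R != 0 :> C by rewrite sqrtC_eq0.
have nsw : `|sqrtC w%:R : C| ^+ 2 = w%:R by rewrite -normrX sqrtCK normr_nat.
exists ((sqrtC w%:R)^-1 *: (H *m K^t*)); last first.
  by rewrite scalerA mulfV // scale1r.
split=> [r s|].
  rewrite mxE normrM normfV.
  case: (HK r s) => [/eqP|rs].
    by rewrite sqrf_eq0 => /eqP ->; left; rewrite mulr0.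
  right; apply/eqP.
  rewrite -(@pexpr_eq1 _ _ 2) ?mulr_ge0 ?invr_ge0 ?normr_ge0 //.
  by rewrite exprMn exprVn nsw rs mulVf.
have -> : ((sqrtC w%:R)^-1 *: (H *m K^t*))^t* =
    (sqrtC w%:R)^-1 *: (K *m H^t*).
  apply/matrixP => r s; rewrite mxE [X in X^*]mxE [X in X^*]mxE [RHS]mxE.
  rewrite !mulmx_conj_trE rmorphM /= dot_conj fmorphV /= (conj_Creal _) //.
  by rewrite ger0_real // sqrtC_ge0 ler0n.
rewrite -scalemxAl -scalemxAr scalerA mulmxA -(mulmxA H).
rewrite (scaled_unitary_cols w0 KK) mul_mx_scalar -scalemxAl HH.
rewrite !scale_scalar_mx; congr (_%:M).
have e := sqrtCK (w%:R : C); set q := sqrtC _ in e sw0 *; rewrite -e; by field.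
Qed.

Lemma cube_root_norm (C : numClosedFieldType) (u : C) : u ^+ 3 = 1 -> `|u| = 1.
Proof.
by move=> u3; apply/eqP; rewrite -(@pexpr_eq1 _ _ 3) // -normrX u3 normr1.
Qed.

Lemma cube_root_conj (C : numClosedFieldType) (u : C) :
  u ^+ 3 = 1 -> u^* = u ^+ 2.
Proof.
move=> u3; have uu : u * u^* = 1 by rewrite -normCK (cube_root_norm u3) expr1n.
by rewrite -[u^*]mul1r -u3 exprSr -mulrA uu mulr1.
Qed.

Lemma cube_roots_neq (C : numClosedFieldType) (u v : C) :
  u ^+ 3 = 1 -> v ^+ 3 = 1 -> u != v -> u ^+ 2 + u * v + v ^+ 2 = 0.
Proof.
move=> u3 v3 uv; apply: (mulfI (x := u - v)); first by rewrite subr_eq0.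
by rewrite mulr0 -[RHS](subrr 1) -{1}u3 -v3; ring.
Qed.

Lemma norm_sub_cube_roots (C : numClosedFieldType) (u v : C) :
  u ^+ 3 = 1 -> v ^+ 3 = 1 -> `|u - v| ^+ 2 = 0 \/ `|u - v| ^+ 2 = 3.
Proof.
move=> u3 v3; have [->|uv] := eqVneq u v; [left|right].
  by rewrite subrr normr0 expr0n.
rewrite normCK rmorphB /= !cube_root_conj //.
transitivity (u ^+ 3 + 2 * v ^+ 3 - v * (u ^+ 2 + u * v + v ^+ 2)).
  by ring.
by rewrite u3 v3 cube_roots_neq //; ring.
Qed.

(** Three distinct cube roots of unity sum to 0; if exactly two agree, the sum
    is x + x + y with 1 + y/x + (y/x)^2 = 0, of squared modulus 3. *)
Lemma norm_add3_cube_roots (C : numClosedFieldType) (u v w : C) :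
  u ^+ 3 = 1 -> v ^+ 3 = 1 -> w ^+ 3 = 1 -> ~ (u = v /\ u = w) ->
  `|u + v + w| ^+ 2 = 0 \/ `|u + v + w| ^+ 2 = 3.
Proof.
have two x y : x ^+ 3 = 1 -> y ^+ 3 = 1 -> x != y -> `|x + x + y| ^+ 2 = 3 :> C.
  move=> x3 y3 xy; rewrite normCK !rmorphD /= !cube_root_conj //.
  transitivity (4 * x ^+ 3 - y ^+ 3 + 2 * y * (x ^+ 2 + x * y + y ^+ 2)).
    by ring.
  by rewrite x3 y3 cube_roots_neq //; ring.
move=> u3 v3 w3 neq.
have [uv|uv] := eqVneq u v.
  right; rewrite -uv; apply: two => //.
  by apply/eqP => uw; apply: neq.
have [uw|uw] := eqVneq u w.
  by right; rewrite -uw addrAC; apply: two.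
have [vw|vw] := eqVneq v w.
  by right; rewrite -vw -addrA addrC; apply: two => //; rewrite eq_sym.
left; have -> : u + v + w = 0; last by rewrite normr0 expr0n.
apply: (mulfI (x := v - w)); first by rewrite subr_eq0.
rewrite mulr0.
transitivity ((u ^+ 2 + u * v + v ^+ 2) - (u ^+ 2 + u * w + w ^+ 2)).
  by ring.
by rewrite !cube_roots_neq // subrr.
Qed.

Lemma exists_cube_root_neq1 (C : numClosedFieldType) :
  exists2 z : C, z ^+ 3 = 1 & z != 1.
Proof.
pose z : C := (-1 + 'i * sqrtC 3) / 2.
have zz : z ^+ 2 + z + 1 = 0.
  have e : ('i * sqrtC 3) ^+ 2 = - 3 :> C.
    by rewrite exprMn (sqrCi C) sqrtCK mulN1r.
  transitivity ((('i * sqrtC 3 : C) ^+ 2 + 3) / 4); first by rewrite /z; field.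
  by rewrite e addNr mul0r.
exists z.
  apply/eqP; rewrite -subr_eq0; apply/eqP.
  transitivity ((z - 1) * (z ^+ 2 + z + 1)); first by ring.
  by rewrite zz mulr0.
apply/eqP => z1; move: zz; rewrite z1 => /eqP.
have -> : 1 ^+ 2 + 1 + 1 = 3 :> C by ring.
by rewrite pnatr_eq0.
Qed.

Definition twist (C : numClosedFieldType) n (W : 'M[C]_n) (d : 'I_n -> C) :
  'M[C]_n :=
  \matrix_(r, k) (W r k * d k).

Lemma dot_twist (C : numClosedFieldType) n (W : 'M[C]_n) d e r s :
  (twist W d *m (twist W e)^t*) r s =
  \sum_k W r k * (W s k)^* * (d k * (e k)^*).
Proof.
rewrite mulmx_conj_trE /dot; apply: eq_bigr => k _.
by rewrite !mxE rmorphM mulrACA.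
Qed.

Lemma unit_weighing_twist (C : numClosedFieldType) n w (W : 'M[C]_n) d :
  unit_weighing w W -> (forall k, `|d k| = 1) -> unit_weighing w (twist W d).
Proof.
move=> [W01 WW] d1; split=> [r k|]; first by rewrite mxE normrM d1 mulr1.
rewrite -WW; apply/matrixP => r s; rewrite dot_twist mulmx_conj_trE.
by apply: eq_bigr => k _; rewrite -normCK d1 expr1n mulr1.
Qed.

(** Twisting preserves weighing matrices, so the only condition left
    concerns the entries of the cross products, where just the ratios of the
    diagonals matter. *)
Lemma mub_family_twist (C : numClosedFieldType) n (T : finType) (W : 'M[C]_n)
    (d : T -> 'I_n -> C) :
  unit_weighing 3 W -> (forall a k, d a k ^+ 3 = 1) ->
  (forall a b, a <> b -> forall r s,
    let x := \sum_k W r k * (W s k)^* * (d a k * (d b k)^*) in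
    `|x| ^+ 2 = 0 \/ `|x| ^+ 2 = 3) ->
  mub_family (fun a => twist W (d a)).
Proof.
move=> Ww d3 dx.
have Hw a : unit_weighing 3 (twist W (d a)).
  by apply: unit_weighing_twist => // k; apply: cube_root_norm.
split=> // a b ab; apply: unbiased_of_norm => // r s.
by rewrite dot_twist; apply: dx.
Qed.

Lemma ratio_cube (C : numClosedFieldType) (u v : C) :
  u ^+ 3 = 1 -> v ^+ 3 = 1 -> (u * v^*) ^+ 3 = 1.
Proof. by move=> u3 v3; rewrite exprMn -rmorphXn /= u3 v3 conjC1 mulr1. Qed.

Lemma ratio_eq1 (C : numClosedFieldType) (u v : C) :
  v ^+ 3 = 1 -> u * v^* = 1 -> u = v.
Proof.
move=> v3; rewrite cube_root_conj // => uv.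
by rewrite -[u]mulr1 -v3 exprSr mulrA uv mul1r.
Qed.

Lemma cube_root_powers_inj (C : numClosedFieldType) (z : C) (a b : 'I_3) :
  z ^+ 3 = 1 -> z != 1 -> z ^+ a = z ^+ b -> a = b.
Proof.
move=> z3 /eqP z1 e; apply: val_inj; move: e.
have z2 : z ^+ 2 <> 1 by move=> z2; apply: z1; rewrite -z3 exprS z2 mulr1.
have z12 : z <> z ^+ 2.
  by move=> z12; apply: z1; rewrite -z3 exprS -z12 -expr2.
case: a b => [[|[|[|//]]] ?] [[|[|[|//]]] ?] //=; rewrite ?expr0 ?expr1 => e //.
all: by exfalso; auto.
Qed.

(** Fourier matrix with diagonals (1, x, 1).  With t and y the ratios of the
    row parameters and of the diagonals, a cross product entry is
    1 + t y + t^2, and its terms all agree only if t = 1 and y = 1. *)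
Lemma mub_family3 (C : numClosedFieldType) :
  exists H : 'I_3 -> 'M[C]_3, mub_family H.
Proof.
have [z z3 z1] := exists_cube_root_neq1 C.
pose F : 'M[C]_3 := \matrix_(r, k) (z ^+ r) ^+ k.
pose d (a k : 'I_3) : C := if k == 1%N :> nat then z ^+ a else 1.
pose t (r s : 'I_3) : C := z ^+ r * (z ^+ s)^*.
have zc k : (z ^+ k) ^+ 3 = 1 by rewrite exprAC z3 expr1n.
have tc r s : t r s ^+ 3 = 1 by apply: ratio_cube.
have t_eq1 r s : t r s = 1 -> r = s.
  by move=> /(ratio_eq1 (zc s)); apply: cube_root_powers_inj.
have FF r s k : F r k * (F s k)^* = t r s ^+ k.
  by rewrite !mxE rmorphXn -exprMn.
have Fw : unit_weighing 3 F.
  split=> [r k|]; first right.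
    by rewrite mxE !normrX (cube_root_norm z3) !expr1n.
  apply/matrixP => r s; rewrite mulmx_conj_trE !mxE /dot.
  under eq_bigr do rewrite FF.
  rewrite !big_ord_recl big_ord0 /= addr0 expr0 expr1.
  have [->|rs] := eqVneq r s.
    rewrite /t -normCK normrX (cube_root_norm z3) !expr1n mulr1n.
    by rewrite /bump /=; ring.
  have t1 : t r s != 1 by apply: contra_neq rs => /t_eq1.
  rewrite mulr0n -(cube_roots_neq (tc r s) (expr1n _ 3) t1).
  by rewrite /bump /=; ring.
exists (fun a => twist F (d a)); apply: mub_family_twist => //.
  by move=> a k; rewrite /d; case: ifP; rewrite ?expr1n.
move=> a b ab r s; rewrite /= !big_ord_recl big_ord0 addr0 addrA !FF /d /=.
rewrite expr0 !expr1 conjC1 !mulr1 /bump /= -/(t a b).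
have ab1 : t a b != 1 by apply/eqP => /t_eq1.
apply: norm_add3_cube_roots.
- exact: expr1n.
- by rewrite exprMn !tc mulr1.
- by rewrite exprAC tc expr1n.
move=> [e1 e2]; have t1 : t r s = 1 by rewrite -(tc r s) exprS -e2 mulr1.
by move: e1; rewrite t1 mul1r => /esym/eqP; apply/negP.
Qed.

(** Two distinct rows of [W] overlap in two coordinates, with opposite signs,
    so after twisting their inner product is a difference of two cube roots.
    Equal rows give sums of three of the four ratios (1, p q, p, q), and any
    three of these being equal forces p = q = 1. *)
Lemma mub_family9 (C : numClosedFieldType) :
  exists H : 'I_3 * 'I_3 -> 'M[C]_4, mub_family H.
Proof.
have [z z3 z1] := exists_cube_root_neq1 C.
pose W : 'M[C]_4 := \matrix_(r, k) nth 0 (nth [::]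
  [:: [:: 0; 1; 1; 1];
      [:: 1; 0; 1; -1];
      [:: 1; -1; 0; 1];
      [:: 1; 1; -1; 0]] r) k.
pose d (a : 'I_3 * 'I_3) (k : 'I_4) : C :=
  nth 0 [:: 1; z ^+ a.1 * z ^+ a.2; z ^+ a.1; z ^+ a.2] k.
pose t (r s : 'I_3) : C := z ^+ r * (z ^+ s)^*.
have zc k : (z ^+ k) ^+ 3 = 1 by rewrite exprAC z3 expr1n.
have tc r s : t r s ^+ 3 = 1 by apply: ratio_cube.
have t_eq1 r s : t r s = 1 -> r = s.
  by move=> /(ratio_eq1 (zc s)); apply: cube_root_powers_inj.
have Wc r k : (W r k)^* = W r k.
  rewrite mxE; case: r k => [[|[|[|[|//]]]] ?] [[|[|[|[|//]]]] ?] /=;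
  by rewrite ?rmorphN /= ?conjC0 ?conjC1.
have Ww : unit_weighing 3 W.
  split=> [r k|].
    rewrite mxE; case: r k => [[|[|[|[|//]]]] ?] [[|[|[|[|//]]]] ?] /=;
    by rewrite ?normrN ?normr0 ?normr1; auto.
  apply/matrixP => r s; rewrite mulmx_conj_trE /dot.
  under eq_bigr do rewrite Wc.
  rewrite !big_ord_recl big_ord0 !mxE /=.
  case: r s => [[|[|[|[|//]]]] ?] [[|[|[|[|//]]]] ?] /=;
    rewrite ?mulr1n ?mulr0n; ring.
exists (fun a => twist W (d a)); apply: mub_family_twist => //.
  move=> a [[|[|[|[|//]]]] ?]; rewrite /d //=; first by rewrite expr1n.
  by rewrite exprMn !zc mulr1.
move=> a b ab r s /=; under eq_bigr do rewrite Wc.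
pose p := t a.1 b.1; pose q := t a.2 b.2.
have dE k : d a k * (d b k)^* = nth 0 [:: 1; p * q; p; q] k.
  case: k => [[|[|[|[|//]]]] ?] //=; rewrite /d /= ?conjC1 ?mulr1 //.
  by rewrite rmorphM /p /q /t mulrACA.
under eq_bigr do rewrite dE.
have p3 : p ^+ 3 = 1 by apply: tc.
have q3 : q ^+ 3 = 1 by apply: tc.
have pq3 : (p * q) ^+ 3 = 1 by rewrite exprMn p3 q3 mulr1.
have o3 : 1 ^+ 3 = 1 :> C by rewrite expr1n.
have pq1 : ~ (p = 1 /\ q = 1).
  move=> [/t_eq1 e1 /t_eq1 e2]; apply: ab.
  by rewrite [a]surjective_pairing [b]surjective_pairing e1 e2.
have nz (x : C) : x ^+ 3 = 1 -> x != 0.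
  by apply: contra_eq_neq => ->; rewrite expr0n eq_sym oner_eq0.
have [p0 q0] : p != 0 /\ q != 0 by split; apply: nz.
have sub (x u v : C) : u ^+ 3 = 1 -> v ^+ 3 = 1 -> x = u - v ->
    `|x| ^+ 2 = 0 \/ `|x| ^+ 2 = 3.
  by move=> u3 v3 ->; apply: norm_sub_cube_roots.
have add (x u v w : C) : u ^+ 3 = 1 -> v ^+ 3 = 1 -> w ^+ 3 = 1 ->
    x = u + v + w -> ~ (u = v /\ u = w) -> `|x| ^+ 2 = 0 \/ `|x| ^+ 2 = 3.
  by move=> u3 v3 w3 -> uvw; apply: norm_add3_cube_roots.
rewrite !big_ord_recl big_ord0 !mxE /=.
case: r s => [[|[|[|[|//]]]] ?] [[|[|[|[|//]]]] ?] /=.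
all: let pair u v := (apply: (sub _ u v) => //; ring) in
  try first [pair (1 : C) (p * q) | pair (p * q) (1 : C)
    | pair (1 : C) p | pair p (1 : C)
    | pair (1 : C) q | pair q (1 : C) | pair (p * q) p | pair p (p * q)
    | pair (p * q) q | pair q (p * q) | pair p q | pair q p ].
(* The diagonal entries remain, each omitting one of the four ratios. *)
- apply: (add _ (p * q) p q) => //; first by ring.
  move=> [e1 e2]; apply: pq1; split.
    by apply: (mulIf q0); rewrite mul1r.
  by apply: (mulfI p0); rewrite mulr1.
- apply: (add _ 1 p q) => //; first by ring.
  by move=> [e1 e2]; apply: pq1.
- apply: (add _ 1 (p * q) q) => //; first by ring.
  by move=> [e1 e2]; apply: pq1; split=> //; move: e1; rewrite -e2 mulr1.
- apply: (add _ 1 (p * q) p) => //; first by ring.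
  by move=> [e1 e2]; apply: pq1; split=> //; move: e1; rewrite -e2 mul1r.
Qed.

(** * Direct sums *)

Lemma mub_family_sub (C : numClosedFieldType) n (T T' : finType) (h : T' -> T)
    (H : T -> 'M[C]_n) :
  injective h -> mub_family H -> mub_family (H \o h).
Proof.
move=> h_inj [Hw Hub]; split=> [a|a b ab]; first exact: Hw.
by apply: Hub => /h_inj.
Qed.

Lemma mub_family_block (C : numClosedFieldType) m n (T : finType)
    (H : T -> 'M[C]_m) (K : T -> 'M[C]_n) :
  mub_family H -> mub_family K ->
  mub_family (fun a => block_mx (H a) 0 0 (K a)).
Proof.
move=> [Hw Hub] [Kw Kub].
have blockM a b : block_mx (H a) 0 0 (K a) *m (block_mx (H b) 0 0 (K b))^t* =
    block_mx (H a *m (H b)^t*) 0 0 (K a *m (K b)^t*).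
  rewrite tr_block_mx map_block_mx !trmx0 !map_mx0 mulmx_block.
  by rewrite !mulmx0 !mul0mx !addr0 add0r.
have entries (P : C -> Prop) (A : 'M[C]_m) (B : 'M[C]_n) : P 0 ->
    (forall i j, P (A i j)) -> (forall i j, P (B i j)) ->
    forall i j, P (block_mx A 0 0 B i j).
  move=> P0 PA PB i j.
  case: (split_ordP i) => i' ->; case: (split_ordP j) => j' ->.
  - by rewrite block_mxEul.
  - by rewrite block_mxEur mxE.
  - by rewrite block_mxEdl mxE.
  - by rewrite block_mxEdr.
have Bw a : unit_weighing 3 (block_mx (H a) 0 0 (K a)).
  have [[H01 HH] [K01 KK]] := (Hw a, Kw a).
  split; last by rewrite blockM HH KK -scalar_mx_block.
  apply: (entries (fun x => `|x| = 0 \/ `|x| = 1)) => //; left.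
  exact: normr0.
split=> // a b ab; apply: unbiased_of_norm => //; rewrite blockM.
apply: (entries (fun x => `|x| ^+ 2 = 0 \/ `|x| ^+ 2 = 3)).
- by left; rewrite normr0 expr0n.
- exact: (unbiased_norm (Hub _ _ ab)).
- exact: (unbiased_norm (Kub _ _ ab)).
Qed.

Lemma mub_family0 (C : numClosedFieldType) (T : finType) :
  mub_family (fun _ : T => 0 : 'M[C]_0).
Proof.
have w0 : unit_weighing 3 (0 : 'M[C]_0) by
  split=> [[]|] //; apply/matrixP => -[].
by split=> // a b _; apply: unbiased_of_norm => // -[].
Qed.

Lemma mub_family_iter (C : numClosedFieldType) m n (T : finType) k :
  (exists H : T -> 'M[C]_m, mub_family H) ->
  (exists H : T -> 'M[C]_n, mub_family H) ->
  exists H : T -> 'M[C]_(k * m + n), mub_family H.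
Proof.
move=> [H mH] [K mK]; elim: k => [|k [L mL]]; first by exists K.
rewrite mulSn -addnA.
by exists (fun a => block_mx (H a) 0 0 (L a)); apply: mub_family_block.
Qed.

Lemma exists_mub_family (C : numClosedFieldType) n :
  n = 3%N \/ n = 4%N \/ (6 <= n)%N ->
  exists H : 'I_(b n) -> 'M[C]_n, mub_family H.
Proof.
move=> hn.
have F0 (T : finType) : exists H : T -> 'M[C]_0, mub_family H.
  by exists (fun=> 0); apply: mub_family0.
have [H9 mH9] := mub_family9 C.
rewrite /b; have [/dvdnP[k nE]|n4] := boolP (4 %| n)%N.
  have -> : n = (k * 4 + 0)%N by rewrite addn0.
  apply: mub_family_iter => //.
  have card9 : 9%N = #|{: 'I_3 * 'I_3}| by rewrite card_prod !card_ord.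
  rewrite /= card9; exists (H9 \o enum_val); apply: mub_family_sub mH9.
  exact: enum_val_inj.
have {n4 hn} [k [l nE]] : exists k l, n = (k * 3 + l * 4)%N.
  have n12 : n = (n %/ 4 * 4 + n %% 4)%N := divn_eq n 4.
  have : (n %% 4 < 4)%N by rewrite ltn_mod.
  move: n12 hn n4; rewrite /dvdn; case: (n %% 4)%N.
    by [].
  move=> [|[|[|//]]] nE hn _ _.
  (* The quotient n %/ 4 is at least 2 here: this excludes n = 1 and n = 5. *)
  - by exists 3, (n %/ 4 - 2)%N; lia.
  - by exists 2, (n %/ 4 - 1)%N; lia.
  - by exists 1, (n %/ 4)%N; lia.
rewrite nE; apply: mub_family_iter; first exact: mub_family3.
rewrite -[(l * 4)%N]addn0; apply: mub_family_iter => //.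
exists (H9 \o (fun i => (i, ord0))); apply: mub_family_sub mH9.
by move=> i j [].
Qed.

(** * Indexed families and sets of matrices *)

Local Open Scope classical_set_scope.
Local Open Scope card_scope.
Local Open Scope ring_scope.
Local Open Scope complex_scope.

(** If two members agreed, the diagonal entries of their cross product would
    be 3, of squared modulus 9 instead of 0 or 3. *)
Lemma mub_family_inj (C : numClosedFieldType) n (T : finType)
    (H : T -> 'M[C]_n) : (0 < n)%N -> mub_family H -> injective H.
Proof.
move=> n_gt0 [Hw Hub] a b Hab; apply/eqP; apply: contraT => /eqP ab.
have := unbiased_norm (Hub _ _ ab) (Ordinal n_gt0) (Ordinal n_gt0).
rewrite Hab; case: (Hw b) => _ ->; rewrite mxE eqxx mulr1n normr_nat.
by rewrite -natrX; case=> /eqP; rewrite ?(eqr_nat _ _ 3) ?pnatr_eq0.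
Qed.

Lemma card_le_of_no_larger T (A : set T) k :
  (forall f : 'I_k.+1 -> T, injective f -> (forall i, A (f i)) -> False) ->
  A #<= `I_k.
Proof.
move=> no_f.
have Ak : ~ (`I_k.+1 #<= A).
  rewrite (card_le_eql card_II) => /card_leP/injfunPex[f _ f_inj].
  pose pt (i : 'I_k.+1) : [set: 'I_k.+1] := SigSub (classical_sets.in_setT i).
  apply: (no_f (fun i => val (f (pt i)))) => [i j /val_inj/f_inj|i].
    by rewrite !classical_sets.in_setT => /(_ isT isT)/(congr1 val).
  exact: set_mem (valP (f (pt i))).
have [/finite_setP[m Am]|/infiniteP natA] := boolp.pselect (finite_set A).
  rewrite (card_le_eql Am) card_le_II leqNgt; apply/negP => km; apply: Ak.
  by rewrite (card_le_eqr Am) card_le_II.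
case: Ak; apply: card_le_trans natA; exact: card_leT.
Qed.

Theorem corollary16 (R : realType) (n : nat)
    (hn : n = 3%N \/ n = 4%N \/ (6 <= n)%N) :
  (forall A : set 'M[R[i]]_n, mutually_unbiased 3 A -> A #<= `I_(b n)) /\
  (exists A : set 'M[R[i]]_n, mutually_unbiased 3 A /\ A #= `I_(b n)).
Proof.
have n_gt0 : (0 < n)%N by lia.
split=> [A [Aw Aub]|].
  apply: card_le_of_no_larger => f f_inj fA.
  have : mub_family f.
    split=> [i|i j ij]; first exact/Aw/fA.
    by apply: Aub => // /f_inj.
  by move/(card_mub_family n_gt0); rewrite card_ord ltnn.
have [H mH] := exists_mub_family R[i] hn.
exists (range H); split.
  case: mH => Hw Hub.
  split=> [_ [a _ <-]|_ _ [a _ <-] [c _ <-] ac]; first exact: Hw.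
  by apply: Hub => E; apply: ac; rewrite E.
have HT : range H #= [set: 'I_(b n)]%classic.
  by apply: inj_card_eq => i j _ _; apply: mub_family_inj.
exact: card_eq_trans HT (card_esym card_II).
Qed.
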